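(* Let $x\in\Omega_{240}$ be a packing of $PG(3,2)$ identified with an $\mathbf{8}$-labelled Fano plane. Let $l\in\mathbf{8}$ be the basepoint of $x$, let $e$ be one of the labels in $x$, and denote the three triples of $x$ containing $e$ by $\{e,a_1,b_1\}$, $\{e,a_2,b_2\}$ and $\{e,a_3,b_3\}$. (i) We have $\overline{(l,e)}\,x=(a_1,b_1)x$ and $\overline{(a_1,b_1)}\,x=(l,e)x$. (ii) We have $(a_1,b_1)x=(a_2,b_2)x=(a_3,b_3)x$ and $\overline{(a_1,b_1)}\,x=\overline{(a_2,b_2)}\,x=\overline{(a_3,b_3)}\,x$. (iii) For any $1\le i<j\le 8$, there exist $1\le c<d\le 8$ such that $\overline{(i,j)}\,x=(c,d)x$. (iv) For any $1\le i<j\le 8$, there exist $1\le c<d\le 5$ such that either $(i,j)x=(c,d)x$ or $(i,j)x=\overline{(c,d)}\,x$.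
   Context: Write $\mathbf{8}=\{1,\dots,8\}$. An $\mathbf{8}$-labelled Fano plane is a set of seven $3$-element subsets (''triples'') of $\mathbf{8}$ that are the lines of a Fano plane $PG(2,2)$ on seven of the eight labels (the labels in it); the unused label is its basepoint. There are $240$ of these; they index and are identified with the packings of $PG(3,2)$ (partitions of the $35$ lines into seven spreads, a spread being a partition of the $15$ points into five lines). Their set is $\Omega_{240}$. Let $V=\mathbb{F}_2^8/U$, where $\mathbb{F}_2^8$ has basis $\varepsilon_1,\dots,\varepsilon_8$ and $U$ is spanned by the all-ones vector. For $A\subseteq\mathbf{8}$ let $v_A$ be the coset of $\sum_{i\in A}\varepsilon_i$. Let $\Lambda^-$ be the set of all $v_A$ with $|A|$ odd. For $x\in\Omega_{240}$ with basepoint $l$, $\lambda^-(x)\subset\Lambda^-$ is the $8$-element set consisting of $v_A$ for the seven triples $A$ of $x$ together with $v_{\{l\}}$; $\lambda^-$ is injective. $W(D_8)$ is the group of signed permutations of $8$ objects involving evenly many sign changes. It contains the transpositions $(i,j)$ and the signed transpositions $\overline{(i,j)}$, where $\overline{(i,j)}$ exchanges objects $i$ and $j$ and changes the sign of each. $W(D_8)$ acts on $\Lambda^-$ as follows: an unsigned permutation permutes the coordinates (sending $\varepsilon_k$ to $\varepsilon_{w(k)}$), and changing the sign of object $i$ acts as adding $\varepsilon_i$; thus $\overline{(i,j)}$ swaps coordinates $i$ and $j$ and then adds $\varepsilon_i+\varepsilon_j$. This action permutes the sets $\lambda^-(x)$, $x\in\Omega_{240}$, and hence induces an action of $W(D_8)$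 on $\Omega_{240}$ via $\lambda^-(wx)=w\lambda^-(x)$; unsigned permutations act on labelled Fano planes by permuting labels. *)

(* Defs.v *)
From HB Require Import structures.
From mathcomp Require Import all_boot all_order all_fingroup all_algebra.
From mathcomp Require Import generic_quotient ring_quotient.
From mathcomp Require mxabelem.

Set Implicit Arguments.
Unset Strict Implicit.
Unset Printing Implicit Defensive.

Import GRing.Theory.
Local Open Scope ring_scope.
Local Open Scope quotient_scope.

(* The label k of {1, ..., 8} is the element of 'I_8 of value k - 1. *)

(* Over F_2 a point of PG(2,2), i.e., a one-dimensional subspace, has a single
   nonzero vector; we identify the point with that vector. *)
Definition pg_points : {set 'rV['F_2]_3} := [set u | u != 0].

Definition pg_lines : {set {set 'rV['F_2]_3}} :=
  [set [set u in pg_points | (u <= W)%MS] | W : 'M['F_2]_3 & \rank W == 2].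

(* x is the image of the set of lines under a labelling f of the seven points;
   the value of f at 0 is irrelevant. *)
Definition labelled_fano (x : {set {set 'I_8}}) : bool :=
  [exists f : {ffun 'rV['F_2]_3 -> 'I_8},
     dinjectiveb f pg_points &&
     (x == [set f @: (L : {set 'rV['F_2]_3}) | L in pg_lines])].

Definition Omega240 : {set {set {set 'I_8}}} := [set x | labelled_fano x].

Definition is_basepoint (x : {set {set 'I_8}}) (l : 'I_8) : bool :=
  l \notin cover x.

Definition U : {vspace 'rV['F_2]_8} := <[const_mx 1]>%VS.

Definition V : Type := Quotient.quot (pred_of_vspace U).
HB.instance Definition _ := GRing.Zmodule.on V.
HB.instance Definition _ := EqQuotient.on V.
HB.instance Definition _ : isCountable V := CanIsCountable (@reprK _ V).
HB.instance Definition _ : isFinite V := CanIsFinite (@reprK _ V).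

Definition vcoset (u : 'rV['F_2]_8) : V := \pi_V u.

Definition eps (i : 'I_8) : 'rV['F_2]_8 := delta_mx 0 i.

Definition coset_set (A : {set 'I_8}) : V := vcoset (\sum_(i in A) eps i).

Definition lambdaM (x : {set {set 'I_8}}) : {set V} :=
  [set coset_set A | A in x] :|: [set coset_set [set l] | l in is_basepoint x].

(* Signed permutations are realised as permutations of the 16 pairs (i, b),
   where b = true marks the negative of object i. *)
Definition signed_obj : finType := ('I_8 * bool)%type.

Lemma signed_perm_inj (s : 'S_8) (S : {set 'I_8}) :
  injective (fun p : signed_obj => (s p.1, p.2 (+) (s p.1 \in S))).
Proof. by move=> [i b] [j c] /= [/perm_inj ->] /addIb ->. Qed.

(* Permute the objects by s, then change the signs of the objects in S. *)
Definition signed_perm (s : 'S_8) (S : {set 'I_8}) : {perm signed_obj} :=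
  perm (@signed_perm_inj s S).

Definition WD8 : {set {perm signed_obj}} :=
  [set w | [exists s : 'S_8, exists S : {set 'I_8},
              ~~ odd #|S| && (w == signed_perm s S)]].

Definition transp (i j : 'I_8) := signed_perm (tperm i j) set0.
Definition stransp (i j : 'I_8) := signed_perm (tperm i j) [set i; j].

(* If w maps object i to object k, with a sign change when b = true, then the
   coordinate k of w u is u_i + b. *)
Definition actF (w : {perm signed_obj}) (u : 'rV['F_2]_8) : 'rV['F_2]_8 :=
  \row_k let: (i, b) := (w^-1)%g (k, false) in u 0 i + b%:R.

(* This affine action is defined on all of V; it is compatible with the
   quotient (actV_pi) and is applied below only to the odd cosets.  As products
   of permutations are read left to right, w * w' acts as w followed by w'. *)
Definition actV (w : {perm signed_obj}) (v : V) : V := vcoset (actF w (repr v)).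

(* The element y of Omega240 with lambdaM y = w (lambdaM x).  By actOmegaP and
   lambdaM_inj below, it exists and is unique for w in WD8 and x in Omega240,
   so that the default value x is then not used. *)
Definition actOmega (w : {perm signed_obj}) (x : {set {set 'I_8}}) :
    {set {set 'I_8}} :=
  odflt x [pick y in Omega240 | lambdaM y == actV w @: lambdaM x].

Lemma F2_cases (a : 'F_2) : a = 0 \/ a = 1.
Proof. by case: a => [[|[|n]] lt_n] //; [left | right]; apply/val_inj. Qed.

Lemma F2_addrr (a : 'F_2) : a + a = 0.
Proof. by case: (F2_cases a) => ->; apply/val_inj. Qed.

Lemma F2_addrrV n (u : 'rV['F_2]_n) : u + u = 0.
Proof. by apply/rowP=> k; rewrite !mxE F2_addrr. Qed.

Lemma F2_oppr n (u : 'rV['F_2]_n) : - u = u.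
Proof. by apply/eqP; rewrite eq_sym -addr_eq0 F2_addrrV. Qed.

Fact vcoset_is_zmod_morphism : zmod_morphism vcoset.
Proof. exact: (raddfB (\pi_V : 'rV['F_2]_8 -> V)). Qed.
HB.instance Definition _ :=
  GRing.isZmodMorphism.Build 'rV['F_2]_8 V vcoset vcoset_is_zmod_morphism.

Lemma memU (u : 'rV['F_2]_8) : (u \in U) = (u == 0) || (u == const_mx 1).
Proof.
apply/vlineP/orP=> [[k ->]|[]/eqP->].
- by case: (F2_cases k) => ->; rewrite ?scale0r ?scale1r eqxx; [left | right].
- by exists 0; rewrite scale0r.
by exists 1; rewrite scale1r.
Qed.

Lemma piV_eq (u v : 'rV['F_2]_8) : (vcoset u == vcoset v) = (u + v \in U).
Proof. by rewrite -[in RHS](F2_oppr v) /vcoset Quotient.idealrBE. Qed.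

Lemma vcosetD : {morph vcoset : u v / u + v}.
Proof. exact: raddfD. Qed.

Lemma V_addrr (v : V) : v + v = 0.
Proof.
have ->: v = vcoset (repr v) by apply/esym/reprK.
by rewrite -vcosetD F2_addrrV raddf0.
Qed.

Lemma piV1 : vcoset (const_mx 1) = 0.
Proof.
rewrite -(raddf0 vcoset); apply/eqP.
by rewrite piV_eq addr0 memU eqxx orbT.
Qed.

Lemma WD8P (w : {perm signed_obj}) : reflect
  (exists s (S : {set 'I_8}), ~~ odd #|S| /\ w = signed_perm s S) (w \in WD8).
Proof.
rewrite inE; apply: (iffP existsP) => [[s /existsP[S /andP[evS /eqP->]]]|].
  by exists s, S.
by case=> s [S [evS ->]]; exists s; apply/existsP; exists S; rewrite evS eqxx.
Qed.

Lemma signed_perm_WD8 s (S : {set 'I_8}) : ~~ odd #|S| -> signed_perm s S \in WD8.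
Proof. by move=> evS; apply/WD8P; exists s, S. Qed.

Lemma transp_WD8 i j : transp i j \in WD8.
Proof. by rewrite signed_perm_WD8 ?cards0. Qed.

Lemma stransp_WD8 i j : i != j -> stransp i j \in WD8.
Proof. by move=> neq_ij; rewrite signed_perm_WD8 ?cards2 ?neq_ij. Qed.

Lemma signed_permM s t (S T : {set 'I_8}) :
  (signed_perm s S * signed_perm t T)%g =
  signed_perm (s * t)%g ((t @: S :\: T) :|: (T :\: t @: S)).
Proof.
apply/permP=> [[i b]]; rewrite !permE /= !permE !inE.
rewrite (mem_imset S (s i) (@perm_inj _ t)).
by case: b; case: (s i \in S); case: (t (s i) \in T).
Qed.

Lemma odd_symdiff (A B : {set 'I_8}) :
  odd #|(A :\: B) :|: (B :\: A)| = odd #|A| (+) odd #|B|.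
Proof.
have dAB: [disjoint A :\: B & B :\: A].
  rewrite -setI_eq0; apply/eqP/setP=> k; rewrite !inE.
  by case: (k \in A); case: (k \in B).
rewrite cardsU disjoint_setI0 // cards0 subn0.
rewrite -[#|A|](cardsID B) -[in RHS](cardsID A B) (setIC B).
by rewrite !oddD addbACA addbb.
Qed.

Lemma WD8_group_set : group_set WD8.
Proof.
apply/group_setP; split.
  apply/WD8P; exists 1%g, set0; rewrite cards0; split=> //.
  by apply/permP=> [[i b]]; rewrite !permE /= inE addbF.
move=> _ _ /WD8P[s [S [evS ->]]] /WD8P[t [T [evT ->]]].
rewrite signed_permM signed_perm_WD8 // odd_symdiff.
by rewrite (card_imset _ (@perm_inj _ t)) (negPf evS) (negPf evT).
Qed.
Canonical WD8_group := Group WD8_group_set.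

Lemma actF_signed_perm s S u :
  actF (signed_perm s S) u = \row_k (u 0 (s^-1 k)%g + (k \in S)%:R).
Proof.
apply/rowP=> k; rewrite !mxE.
suff ->: ((signed_perm s S)^-1)%g (k, false) = ((s^-1)%g k, k \in S) by [].
by apply: (canLR (permK _)); rewrite permE /= permKV addbb.
Qed.

Definition ind (S : {set 'I_8}) : 'rV['F_2]_8 := \sum_(i in S) eps i.

Lemma indE S k : ind S 0 k = (k \in S)%:R.
Proof.
rewrite summxE (eq_bigr (fun i => (k == i)%:R)) => [|i _]; last by rewrite mxE eqxx.
have [kS|kS] := boolP (k \in S).
  rewrite (bigD1 k) //= eqxx big1 ?addr0 // => i /andP[_ /negPf].
  by rewrite eq_sym => ->.
by rewrite big1 // => i iS; case: eqP kS => // ->; rewrite iS.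
Qed.

Lemma coset_setE S : coset_set S = vcoset (ind S).
Proof. by []. Qed.

Lemma coset_set1 i : coset_set [set i] = vcoset (eps i).
Proof. by rewrite /coset_set big_set1. Qed.

Lemma actV_pi w u : actV w (vcoset u) = vcoset (actF w u).
Proof.
apply/eqP; rewrite /actV piV_eq.
have: repr (vcoset u) + u \in U by rewrite -piV_eq; apply/eqP; apply: reprK.
rewrite !memU => /orP[] /eqP/rowP eq_u; apply/orP; [left | right];
  apply/eqP/rowP=> k; rewrite !mxE; case: (_ (k, false)) => i b;
  have := eq_u i; rewrite !mxE addrACA F2_addrr addr0; exact.
Qed.

Definition fano_of (F : 'rV['F_2]_3 -> 'I_8) : {set {set 'I_8}} :=
  [set F @: (L : {set 'rV['F_2]_3}) | L in pg_lines].

Definition hvec (F : 'rV['F_2]_3 -> 'I_8) (phi : 'cV['F_2]_3) : 'rV['F_2]_8 :=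
  \sum_u (u *m phi) 0 0 *: eps (F u).

Lemma card_rV3 : #|[set: 'rV['F_2]_3]| = 8%N.
Proof. by rewrite cardsT card_mx card_Fp. Qed.

Implicit Types (F G : 'rV['F_2]_3 -> 'I_8) (phi : 'cV['F_2]_3).

Lemma sum_eps F : injective F -> \sum_u eps (F u) = const_mx 1.
Proof.
move=> injF; have imF: F @: [set: 'rV['F_2]_3] = [set: 'I_8].
  apply/eqP; rewrite eqEcard subsetT /= (card_imset _ injF) card_rV3.
  by rewrite cardsT card_ord.
transitivity (ind (F @: [set: 'rV['F_2]_3])).
  rewrite /ind big_imset /=; last by move=> u v _ _; apply: injF.
  by apply: eq_bigl => u; rewrite inE.
by apply/rowP=> k; rewrite imF indE inE mxE.
Qed.

Lemma mx11_eq0 (M : 'M['F_2]_1) : (M == 0) = (M 0 0 == 0).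
Proof.
by apply/eqP/eqP=> [->|M0]; [rewrite mxE | apply/matrixP=> i j; rewrite !ord1 M0 mxE].
Qed.

Lemma span2 (p q : 'rV['F_2]_3) : p != 0 -> q != 0 -> p != q ->
  \rank (p + q)%MS = 2%N.
Proof.
move=> p0 q0 pq; apply/eqP; rewrite eqn_leq.
rewrite (leq_trans (mxrank_adds_leqif p q)) ?rank_rV ?p0 ?q0 //=.
suff: (p < p + q)%MS by move/rank_ltmx; rewrite rank_rV p0.
rewrite ltmxE addsmxSl /=; apply/negP=> /(submx_trans (addsmxSr _ _)).
case/sub_rVP=> a qE; case: (F2_cases a) => aE; move: qE q0 pq; rewrite aE.
  by rewrite scale0r => ->; rewrite eqxx.
by rewrite scale1r => ->; rewrite eqxx.
Qed.

Lemma sub_span2 (p q u : 'rV['F_2]_3) :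
  (u <= p + q)%MS = (u \in [:: 0; p; q; p + q]).
Proof.
apply/idP/idP=> [/sub_addsmxP[[a b] /= ->]|].
  rewrite [a]mx11_scalar [b]mx11_scalar !mul_scalar_mx.
  case: (F2_cases (a 0 0)) => ->; case: (F2_cases (b 0 0)) => ->;
    by rewrite ?scale0r ?scale1r ?addr0 ?add0r !inE eqxx ?orbT.
rewrite !inE => /or4P[] /eqP->; rewrite ?sub0mx ?addsmxSl ?addsmxSr //.
by rewrite addmx_sub_adds ?submx_refl.
Qed.

Lemma pg_lineP (W : 'M['F_2]_3) : \rank W = 2%N ->
  exists2 phi : 'cV['F_2]_3, phi != 0 &
    forall u : 'rV_3, (u <= W)%MS = (u *m phi == 0).
Proof.
move=> rW; pose K := kermx W^T.
have rK: \rank K = 1%N by rewrite mxrank_ker mxrank_tr rW.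
have K0: K != 0 by rewrite -mxrank_eq0 rK.
exists (nz_row K)^T; first by rewrite -(trmx0) (inj_eq trmx_inj) nz_row_eq0.
have WK: (W <= kermx (nz_row K)^T)%MS.
  apply/sub_kermxP; apply: trmx_inj; rewrite trmx_mul trmxK trmx0.
  by apply/sub_kermxP; apply: nz_row_sub.
have /eqmxP eqW: (W == kermx (nz_row K)^T)%MS.
  by rewrite -(mxrank_leqif_eq WK) rW mxrank_ker mxrank_tr rank_rV nz_row_eq0 K0.
by move=> u; rewrite eqW; apply/sub_kermxP/eqP.
Qed.

Lemma ker_line (phi : 'cV['F_2]_3) : phi != 0 ->
  [set u in pg_points | u *m phi == 0] \in pg_lines.
Proof.
move=> phi0; apply/imsetP; exists (kermx phi).
  by rewrite inE mxrank_ker -mxrank_tr rank_rV -trmx0 (inj_eq trmx_inj) phi0.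
apply/setP=> u; rewrite !inE; congr (_ && _).
by apply/eqP/sub_kermxP.
Qed.

Lemma ind_line F (phi : 'cV['F_2]_3) : injective F ->
  coset_set (F @: [set u in pg_points | u *m phi == 0]) =
  vcoset (eps (F 0) + hvec F phi).
Proof.
move=> injF; apply/eqP; rewrite coset_setE piV_eq memU; apply/orP; right.
have ->: hvec F phi = \sum_(u | (u != 0) && (u *m phi != 0)) eps (F u).
  rewrite /hvec (bigD1 0) //= mul0mx mxE scale0r add0r.
  rewrite (bigID (fun u => u *m phi == 0)) /= big1 ?add0r; last first.
    by move=> u /andP[_ /eqP->]; rewrite mxE scale0r.
  apply: eq_bigr => u /andP[_]; rewrite mx11_eq0.
  by case: (F2_cases ((u *m phi) 0 0)) => ->; rewrite ?eqxx // scale1r.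
have := sum_eps injF.
rewrite (bigD1 0) //= (bigID (fun u : 'rV_3 => u *m phi == 0)) /= => <-.
rewrite /ind big_imset /=; last by move=> u v _ _; apply: injF.
rewrite addrCA; apply/eqP; congr (_ + (_ + _)).
by apply: eq_bigl => u; rewrite !inE.
Qed.

Lemma ex_other (p : 'rV['F_2]_3) : exists2 q : 'rV['F_2]_3, q != 0 & p != q.
Proof.
have d0 i: delta_mx 0 i != 0 :> 'rV['F_2]_3.
  by apply/eqP=> /rowP/(_ i); rewrite !mxE !eqxx.
have [->|pq] := eqVneq p (delta_mx 0 0); last by exists (delta_mx 0 0).
exists (delta_mx 0 1) => //; apply/eqP=> /rowP/(_ 0); rewrite !mxE //.
Qed.

Lemma is_basepoint_fano F l : injective F ->
  is_basepoint (fano_of F) l = (l == F 0).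
Proof.
move=> injF; rewrite /is_basepoint; have imF: F @: [set: 'rV['F_2]_3] = [set: 'I_8].
  apply/eqP; rewrite eqEcard subsetT /= (card_imset _ injF) card_rV3.
  by rewrite cardsT card_ord.
have /imsetP[p _ ->]: l \in F @: [set: 'rV['F_2]_3] by rewrite imF inE.
rewrite (inj_eq injF); apply/idP/eqP=> [|->].
  apply: contraNeq => p0; have [q q0 pq] := ex_other p.
  apply/bigcupP; exists (F @: [set u in pg_points | (u <= p + q)%MS]).
    by apply/imset_f/imsetP; exists (p + q)%MS; rewrite ?inE ?span2.
  by apply: imset_f; rewrite !inE p0 addsmxSl.
apply/negP=> /bigcupP[_ /imsetP[_ /imsetP[W _ ->] ->]].
case/imsetP=> u; rewrite !inE => /andP[u0 _] /injF uE.
by rewrite uE eqxx in u0.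
Qed.

Lemma fano_ofP x : reflect (exists2 F, injective F & x = fano_of F) (x \in Omega240).
Proof.
rewrite inE; apply: (iffP existsP) => [[f /andP[/dinjectiveP injf /eqP->]]|].
  have cpts: #|f @: pg_points| = 7%N.
    rewrite card_in_imset // /pg_points; have := cardsC1 (0 : 'rV['F_2]_3).
    rewrite -cardsT card_rV3 /= => <-.
    by apply: eq_card => u; rewrite !inE.
  have [l lf]: exists l, l \notin f @: pg_points.
    apply/existsP; rewrite -negb_forall; apply/negP=> /forallP allf.
    have: f @: pg_points = [set: 'I_8].
      by apply/setP=> l; rewrite inE; apply: allf.
    by move=> E; move: cpts; rewrite E cardsT card_ord.
  exists (fun u => if u == 0 then l else f u).
    move=> u v; have [->|u0] := eqVneq u 0; have [->|v0] := eqVneq v 0 => //.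
    - by move=> E; case/imsetP: lf; exists v; rewrite ?inE.
    - by move=> E; case/imsetP: lf; exists u; rewrite ?inE.
    by apply: injf; rewrite inE.
  apply: eq_in_imset => _ /imsetP[W _ ->]; apply: eq_in_imset => u.
  by rewrite !inE => /andP[/negPf-> _].
case=> F injF ->; exists [ffun u => F u]; apply/andP; split.
  by apply/dinjectiveP=> u v _ _; rewrite !ffunE; apply: injF.
by apply/eqP; apply: eq_imset => L; apply: eq_imset => u; rewrite ffunE.
Qed.

Lemma hvec0 F : hvec F 0 = 0.
Proof. by rewrite /hvec big1 // => u _; rewrite mulmx0 mxE scale0r. Qed.

Lemma hvecD F phi psi : hvec F (phi + psi) = hvec F phi + hvec F psi.
Proof.
rewrite /hvec -big_split /=; apply: eq_bigr => u _.
by rewrite mulmxDr mxE scalerDl.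
Qed.

Lemma lambda_fano F : injective F ->
  lambdaM (fano_of F) = [set vcoset (eps (F 0) + hvec F phi) | phi : 'cV['F_2]_3].
Proof.
move=> injF; apply/setP=> v; apply/setUP/imsetP=> [[]|[phi _ ->]].
- case/imsetP=> _ /imsetP[_ /imsetP[W Wr ->] ->] ->.
  rewrite inE in Wr; have [phi phi0 WE] := pg_lineP (eqP Wr); exists phi => //.
  rewrite -ind_line //; have -> // : [set u in pg_points | (u <= W)%MS] =
    [set u in pg_points | u *m phi == 0] by apply/setP=> u; rewrite !inE WE.
- case/imsetP=> l; rewrite -topredE /= is_basepoint_fano // => /eqP-> ->.
  by exists 0; rewrite // hvec0 addr0 coset_set1.
have [->|phi0] := eqVneq phi 0.
  right; apply/imsetP; exists (F 0); last by rewrite hvec0 addr0 coset_set1.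
  by rewrite -topredE /= is_basepoint_fano.
by left; rewrite -ind_line //; do 2![apply: imset_f]; apply: ker_line.
Qed.

Lemma hvec_shift F p phi : injective F ->
  hvec (fun u => F (u + p)) phi = hvec F phi + (p *m phi) 0 0 *: const_mx 1.
Proof.
move=> injF; rewrite -(sum_eps injF) scaler_sumr /hvec -big_split /=.
rewrite [RHS](reindex_inj (addIr p)) /=; apply: eq_bigr => u _.
have uE: u *m phi = (u + p) *m phi + p *m phi.
  by rewrite mulmxDl -addrA F2_addrrV addr0.
by rewrite -scalerDl [in LHS]uE mxE.
Qed.

Lemma piV_scale1 a : vcoset (a *: const_mx 1) = 0.
Proof. by case: (F2_cases a) => ->; rewrite ?scale0r ?raddf0 // scale1r piV1. Qed.

Lemma lambda_shift F p : injective F ->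
  lambdaM (fano_of (fun u => F (u + p))) =
  [set v + vcoset (eps (F 0) + eps (F p)) | v in lambdaM (fano_of F)].
Proof.
move=> injF; have injG: injective (fun u => F (u + p)) by move=> u v /injF/addIr.
rewrite !lambda_fano // -imset_comp; apply: eq_imset => phi /=.
rewrite hvec_shift // add0r -vcosetD addrACA F2_addrrV add0r.
by rewrite [hvec F phi + _]addrC !vcosetD piV_scale1 add0r addrC.
Qed.

Lemma lambda_pair F i j : injective F -> i != j ->
  exists2 G, injective G & lambdaM (fano_of G) =
    [set v + vcoset (eps i + eps j) | v in lambdaM (fano_of F)].
Proof.
move=> injF; have imF: F @: [set: 'rV['F_2]_3] = [set: 'I_8].
  apply/eqP; rewrite eqEcard subsetT /= (card_imset _ injF) card_rV3.
  by rewrite cardsT card_ord.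
have /imsetP[p _ ->]: i \in F @: [set: 'rV['F_2]_3] by rewrite imF inE.
have /imsetP[q _ ->]: j \in F @: [set: 'rV['F_2]_3] by rewrite imF inE.
rewrite (inj_eq injF) => pq.
have injS r: injective (fun u => F (u + r)) by move=> u v /injF/addIr.
have [p0|p0] := eqVneq p 0.
  by exists (fun u => F (u + q)) => //; rewrite lambda_shift // p0.
have [q0|q0] := eqVneq q 0.
  by exists (fun u => F (u + p)) => //; rewrite lambda_shift // q0 [eps _ + _]addrC.
exists (fun u => F (u + (p + q))) => //; rewrite lambda_shift //.
have [phi phi0 phiE] := pg_lineP (span2 p0 q0 pq).
have Lphi: [set u in pg_points | u *m phi == 0] = [set p; q; p + q].
  apply/setP=> u; rewrite !inE -phiE sub_span2 !inE.
  have pq0: p + q != 0 by rewrite addr_eq0 F2_oppr.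
  have [->|u0] //= := eqVneq u 0; last by rewrite orbA.
  by rewrite !(eq_sym 0) (negPf p0) (negPf q0) (negPf pq0).
have pq_p: p != p + q by rewrite eq_sym -subr_eq0 addrC addKr.
have pq_q: q != p + q by rewrite eq_sym -subr_eq0 addrK.
have pqE: vcoset (eps (F p) + eps (F q)) =
          vcoset (hvec F phi) + vcoset (eps (F 0) + eps (F (p + q))).
  have := ind_line phi injF; rewrite Lphi coset_setE /ind big_imset /=; last first.
    by move=> u v _ _; apply: injF.
  rewrite -setUA big_setU1 ?big_setU1 ?big_set1 ?inE ?negb_or ?pq ?pq_p ?pq_q //=.
  rewrite addrA [eps (F 0) + _]addrC !vcosetD => E.
  by rewrite [RHS]addrA -E -addrA V_addrr addr0.
rewrite !lambda_fano // -!imset_comp; apply/setP=> v.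
apply/imsetP/imsetP=> [] [psi _ ->]; exists (psi + phi) => //=.
  rewrite pqE hvecD !vcosetD -!addrA; congr (_ + (_ + _)).
  by rewrite [RHS]addrA V_addrr add0r.
by rewrite pqE hvecD !vcosetD -!addrA.
Qed.

Lemma ind_pair (S : {set 'I_8}) i j : i \in S -> j \in S -> i != j ->
  ind S = ind (S :\ i :\ j) + (eps i + eps j).
Proof.
move=> iS jS ij; rewrite /ind (big_setD1 i) //= (big_setD1 j) /=; last first.
  by rewrite !inE eq_sym ij jS.
by rewrite addrA addrC.
Qed.

Lemma lambda_even F (S : {set 'I_8}) : injective F -> ~~ odd #|S| ->
  exists2 G, injective G & lambdaM (fano_of G) =
    [set v + vcoset (ind S) | v in lambdaM (fano_of F)].
Proof.
move=> injF; have [n] := ubnP #|S|; elim: n => // n IHn in S * => ltSn evS.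
have [->|[i iS]] := set_0Vmem S.
  exists F => //; rewrite /ind big_set0 raddf0.
  by rewrite (eq_imset (g := id)) ?imset_id // => v; rewrite addr0.
have [S0|[j jS]] := set_0Vmem (S :\ i).
  by move: evS; rewrite (cardsD1 i) iS S0 cards0.
have /setD1P[ji jS'] := jS.
have cS: #|S| = (#|S :\ i :\ j|).+2 by rewrite (cardsD1 i) iS (cardsD1 j (S :\ i)) jS.
have [||G injG GE] := IHn (S :\ i :\ j).
- by move: ltSn; rewrite cS ltnS => /ltnW.
- by move: evS; rewrite cS /= negbK.
have [|H injH HE] := @lambda_pair G i j injG; first by rewrite eq_sym.
exists H => //; rewrite HE GE -imset_comp; apply: eq_imset => v /=.
by rewrite (ind_pair iS jS') 1?eq_sym // [vcoset (ind _ + _)]vcosetD addrA.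
Qed.

Lemma actF_eps_sum s (S : {set 'I_8}) F (c : 'rV['F_2]_3 -> 'F_2) :
  actF (signed_perm s S) (\sum_u c u *: eps (F u)) =
  \sum_u c u *: eps (s (F u)) + ind S.
Proof.
rewrite actF_signed_perm; apply/rowP=> k; rewrite !mxE indE !summxE; congr (_ + _).
apply: eq_bigr => u _; rewrite !mxE !eqxx /=.
by rewrite (can2_eq (permKV s) (permK s)).
Qed.

Lemma actV_lambda F s S : injective F ->
  actV (signed_perm s S) @: lambdaM (fano_of F) =
  [set v + vcoset (ind S) | v in lambdaM (fano_of (s \o F))].
Proof.
move=> injF; have injG: injective (s \o F) by apply: inj_comp => //; apply: perm_inj.
rewrite !lambda_fano // -!imset_comp; apply: eq_imset => phi /=.
have hE (G : 'rV['F_2]_3 -> 'I_8) : eps (G 0) + hvec G phi =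
    \sum_u ((u == 0)%:R + (u *m phi) 0 0) *: eps (G u).
  under eq_bigr do rewrite scalerDl; rewrite big_split /=; congr (_ + _).
  rewrite (bigD1 0) //= eqxx scale1r big1 ?addr0 // => u /negPf->.
  by rewrite scale0r.
by rewrite actV_pi !hE actF_eps_sum vcosetD.
Qed.

Lemma coset_set_eq (A B : {set 'I_8}) :
  (coset_set A == coset_set B) = (A == B) || (A == ~: B).
Proof.
rewrite !coset_setE piV_eq memU; congr (_ || _).
  apply/eqP/eqP=> [/rowP E|->]; last exact: F2_addrrV.
  apply/setP=> k; have := E k; rewrite !mxE !indE.
  by case: (k \in A); case: (k \in B).
apply/eqP/eqP=> [/rowP E|->].
  apply/setP=> k; have := E k; rewrite !mxE !indE inE.
  by case: (k \in A); case: (k \in B).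
apply/rowP=> k; rewrite !mxE !indE inE.
by case: (k \in B); apply/val_inj.
Qed.

Lemma card_triple F A : injective F -> A \in fano_of F -> #|A| = 3%N.
Proof.
move=> injF /imsetP[_ /imsetP[W Wr ->] ->]; rewrite (card_imset _ injF).
rewrite inE in Wr.
have := mxabelem.card_rowg W; rewrite (eqP Wr) card_Fp //= => cW.
have: #|mxabelem.rowg W| = (#|[set u in pg_points | (u <= W)%MS]|).+1.
  rewrite (cardsD1 0) inE sub0mx add1n; congr _.+1; apply: eq_card => u.
  by rewrite !inE.
by rewrite cW => -[].
Qed.

Lemma lambdaM_inj : {in Omega240 &, injective lambdaM}.
Proof.
suff sub x y : x \in Omega240 -> y \in Omega240 -> lambdaM x = lambdaM y ->
    x \subset y.
  by move=> x y xO yO E; apply/eqP; rewrite eqEsubset !sub.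
case/fano_ofP=> F injF -> /fano_ofP[G injG ->] E; apply/subsetP=> A Ax.
have cA := card_triple injF Ax.
have: coset_set A \in lambdaM (fano_of G) by rewrite -E inE imset_f.
case/setUP=> /imsetP[B By] /eqP; rewrite coset_set_eq => /orP[] /eqP AB.
- by rewrite AB.
- by have := cardsC B; rewrite -AB cA (card_triple injG By) card_ord.
- by move: cA; rewrite AB cards1.
by have := cardsC [set B]; rewrite -AB cA cards1 card_ord.
Qed.

Lemma actOmegaP w x : w \in WD8 -> x \in Omega240 ->
  actOmega w x \in Omega240 /\ lambdaM (actOmega w x) = actV w @: lambdaM x.
Proof.
case/WD8P=> s [S [evS ->]] /fano_ofP[F injF ->]; rewrite /actOmega.
have injG: injective (s \o F) by apply: inj_comp => //; apply: perm_inj.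
case: pickP => [y /andP[yO /eqP]|] //= noy.
have [G GO GE] := lambda_even injG evS.
have /negP[] := noy (fano_of G); rewrite GE actV_lambda // eqxx andbT.
by apply/fano_ofP; exists G.
Qed.

Lemma lambdaM_actOmega w x : w \in WD8 -> x \in Omega240 ->
  lambdaM (actOmega w x) = actV w @: lambdaM x.
Proof. by move=> wW xO; case: (actOmegaP wW xO). Qed.

Lemma actOmega_signed_perm0 (s : 'S_8) x : x \in Omega240 ->
  actOmega (signed_perm s set0) x = [set s @: (A : {set 'I_8}) | A in x].
Proof.
move=> xO; have sW: signed_perm s set0 \in WD8.
  by rewrite signed_perm_WD8 ?cards0.
have [yO yE] := actOmegaP sW xO; case/fano_ofP: xO yO yE => F injF -> yO yE.
have injG: injective (s \o F) by apply: inj_comp => //; apply: perm_inj.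
have ->: [set s @: (A : {set 'I_8}) | A in fano_of F] = fano_of (s \o F).
  by rewrite /fano_of -imset_comp; apply: eq_imset => L /=; rewrite -imset_comp.
apply: lambdaM_inj => //; first by apply/fano_ofP; exists (s \o F).
rewrite yE actV_lambda // /ind big_set0 raddf0.
by rewrite (eq_imset (g := id)) ?imset_id // => v; rewrite addr0.
Qed.

Lemma actVM w w' v : w \in WD8 -> w' \in WD8 ->
  actV (w * w')%g v = actV w' (actV w v).
Proof.
case/WD8P=> s [S [_ ->]] /WD8P[t [T [_ ->]]].
have ->: v = vcoset (repr v) by apply/esym/reprK.
rewrite !actV_pi; congr vcoset; move: (repr v) => u.
rewrite signed_permM !actF_signed_perm; apply/rowP=> k; rewrite !mxE invMg permM.
rewrite -addrA; congr (_ + _); rewrite !inE.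
have ->: (k \in t @: S) = ((t^-1)%g k \in S).
  by rewrite -{1}[k](permKV t) (mem_imset S _ (@perm_inj _ t)).
by case: (_ \in S); case: (k \in T); apply/val_inj.
Qed.

Lemma actOmegaM w w' x : w \in WD8 -> w' \in WD8 -> x \in Omega240 ->
  actOmega (w * w')%g x = actOmega w' (actOmega w x).
Proof.
move=> wW w'W xO; have [yO yE] := actOmegaP wW xO.
have [zO zE] := actOmegaP w'W yO.
have [|uO uE] := @actOmegaP (w * w')%g x _ xO; first exact: (groupM wW w'W).
apply: lambdaM_inj => //; rewrite uE zE yE -imset_comp.
by apply: eq_imset => v /=; rewrite actVM.
Qed.

(* Main.v *)
Require Import Defs.
From mathcomp Require Import all_boot all_order all_fingroup all_algebra.

(** A labelled Fano plane x with basepoint l comes from a bijection F from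
    F_2^3 to the labels with F 0 = l, its triples being the images of the
    lines.  Then lambdaM x is the coset, in V, of eps l modulo the subspace of
    the vectors hvec F phi, i.e. modulo the extended Hamming code.

    Swapping the labels i and j changes hvec F phi by a multiple of
    eps i + eps j, the scalar being the value of phi at the difference p of the
    points labelled i and j; it also changes eps l by eps i + eps j when l is
    one of i, j.  A sign change adds one more copy of eps i + eps j.  Hence the
    image of lambdaM x consists of the
      eps l + hvec F phi + (c + phi(p)) (eps i + eps j),
    where c in F_2 is the parity of the number of true statements among
    the swap is signed and l is in {i, j}.

    The four pairs of labels with a given difference p are parallel: two of
    them together form an affine plane, whose indicator vector is a codeword
    hvec F psi with psi(p) = 0.  Replacing one pair by another in the formula
    above therefore amounts to reindexing phi by phi + (c + phi(p)) psi, so the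
    image depends on p and c only (actOmega_pswap).  Now the four parts follow.
    The line {e, a, b} says that {a, b} is parallel to {l, e}, which gives (i)
    and (ii).  Exactly one pair of each parallel class contains l, so the sign
    may be traded for a different choice of pair: this is (iii).  The four pairs
    of a parallel class partition the eight labels, so that one of them lies
    within any given five labels: this is (iv). *)

Set Implicit Arguments.
Unset Strict Implicit.
Unset Printing Implicit Defensive.

Import GRing.Theory.
Local Open Scope ring_scope.

(** * Swaps of two labels *)

(** Treating the sign as a parameter makes the exchange of transp and stransp
    in the statements a matter of parity. *)
Definition pswap (b : bool) (i j : 'I_8) : {perm signed_obj} :=
  signed_perm (tperm i j) (if b then [set i; j] else set0).

Lemma pswapC b i j : pswap b i j = pswap b j i.
Proof. by rewrite /pswap tpermC setUC. Qed.

Lemma pswap_WD8 b i j : i != j -> pswap b i j \in WD8.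
Proof. by case: b => ij; [apply: stransp_WD8 | apply: transp_WD8]. Qed.

Lemma F2_natr_addb (b c : bool) : (b (+) c)%:R = b%:R + c%:R :> 'F_2.
Proof. by case: b; case: c; apply/val_inj. Qed.

Lemma labelling_bij (F : 'rV['F_2]_3 -> 'I_8) : injective F -> bijective F.
Proof.
by move=> injF; apply: inj_card_bij => //; rewrite card_ord -cardsT card_rV3.
Qed.

(** The image of lambdaM of a plane under swaps of difference p, with the pair
    labelled by 0 and p as reference pair of the parallel class. *)
Definition swapped (F : 'rV['F_2]_3 -> 'I_8) (c : bool) (p : 'rV['F_2]_3) :
    {set V} :=
  [set vcoset (eps (F 0) + hvec F phi
               + (c%:R + (p *m phi) 0 0) *: (eps (F 0) + eps (F p)))
  | phi : 'cV['F_2]_3].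

Section Labelling.

Variables (F : 'rV['F_2]_3 -> 'I_8) (G : 'I_8 -> 'rV['F_2]_3).
Hypotheses (FK : cancel F G) (GK : cancel G F).

Let injF : injective F := can_inj FK.
Let injG : injective G := can_inj GK.

Lemma hvecE (phi : 'cV['F_2]_3) k : hvec F phi 0 k = (G k *m phi) 0 0.
Proof.
rewrite summxE (bigD1 (G k)) //= big1 ?addr0 => [|u uk].
  by rewrite !mxE GK !eqxx mulr1.
rewrite !mxE eqxx /=; case: eqP => [kE|]; last by rewrite mulr0.
by rewrite kE FK eqxx in uk.
Qed.

(** Two parallel pairs form an affine plane, and the indicator vector of an
    affine plane is a codeword modulo the all-ones vector. *)
Lemma parallel_pairs p r : p != 0 -> exists2 psi : 'cV['F_2]_3,
    (p *m psi) 0 0 = 0 &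
    vcoset (eps (F r) + eps (F (r + p))) =
    vcoset (eps (F 0) + eps (F p) + hvec F psi).
Proof.
move=> p0; have [->|r0] := eqVneq r 0.
  by exists 0; rewrite ?mulmx0 ?mxE // add0r hvec0 addr0.
have [->|pr] := eqVneq p r.
  by exists 0; rewrite ?mulmx0 ?mxE // F2_addrrV hvec0 addr0 addrC.
have [psi psi0 psiE] := pg_lineP (span2 p0 r0 pr).
exists psi.
  by have := psiE p; rewrite addsmxSl => /esym/eqP->; rewrite mxE.
have pr0: p + r != 0 by rewrite addr_eq0 F2_oppr.
have Lpsi: [set u in pg_points | u *m psi == 0] = [set p; r; p + r].
  apply/setP=> u; rewrite !inE -psiE sub_span2 !inE.
  have [->|u0] //= := eqVneq u 0; last by rewrite orbA.
  by rewrite !(eq_sym 0) (negPf p0) (negPf r0) (negPf pr0).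
have p_pr: p != p + r by rewrite eq_sym -subr_eq0 addrC addKr.
have r_pr: r != p + r by rewrite eq_sym -subr_eq0 addrK.
have := ind_line psi injF; rewrite Lpsi coset_setE /ind big_imset /=; last first.
  by move=> u v _ _; apply: injF.
rewrite -setUA big_setU1 ?big_setU1 ?big_set1 ?inE ?negb_or ?pr ?p_pr ?r_pr //=.
rewrite (addrC r) [eps (F 0) + _]addrC -[_ + _ + hvec _ _]addrA !vcosetD => E.
by rewrite addrCA [vcoset (eps (F 0)) + _]addrC -E addrA V_addrr add0r.
Qed.

(** Changing the pair within its parallel class only reindexes phi. *)
Lemma swappedE (c : bool) p r : p != 0 ->
  [set vcoset (eps (F 0) + hvec F phi
               + (c%:R + (p *m phi) 0 0) *: (eps (F r) + eps (F (r + p))))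
  | phi : 'cV['F_2]_3] = swapped F c p.
Proof.
move=> p0; have [psi ppsi E] := parallel_pairs r p0.
(* As psi vanishes at p, the coefficient of psi below is the same for phi and
   s phi, so that s is an involution over F_2. *)
pose s (phi : 'cV['F_2]_3) := phi + (c%:R + (p *m phi) 0 0) *: psi.
have ps phi : (p *m s phi) 0 0 = (p *m phi) 0 0.
  by rewrite mulmxDr -scalemxAr mxE [X in _ + X]mxE ppsi mulr0 addr0.
have sK phi : s (s phi) = phi.
  by rewrite {1}/s ps /s -addrA -scalerDl F2_addrr scale0r addr0.
have hs phi : vcoset (eps (F 0) + hvec F phi
    + (c%:R + (p *m phi) 0 0) *: (eps (F r) + eps (F (r + p)))) =
  vcoset (eps (F 0) + hvec F (s phi)
    + (c%:R + (p *m s phi) 0 0) *: (eps (F 0) + eps (F p))).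
  rewrite ps /s hvecD; case: (F2_cases (c%:R + (p *m phi) 0 0)) => ->.
    by rewrite !scale0r hvec0 !addr0.
  rewrite !scale1r vcosetD E -vcosetD; congr vcoset.
  by rewrite -!addrA; congr (_ + (_ + _)); rewrite [RHS]addrC -addrA.
apply/setP=> v; apply/imsetP/imsetP=> [] [phi _ ->]; exists (s phi) => //.
by rewrite hs sK.
Qed.

Lemma hvec_tperm i j phi :
  hvec (tperm i j \o F) phi =
  hvec F phi + ((G i + G j) *m phi) 0 0 *: (eps i + eps j).
Proof.
have -> : hvec (tperm i j \o F) phi = \row_k (G (tperm i j k) *m phi) 0 0.
  apply/rowP=> k; rewrite summxE mxE (bigD1 (G (tperm i j k))) //= big1.
    by rewrite !mxE GK tpermK !eqxx mulr1 addr0.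
  move=> u uk; rewrite !mxE eqxx /=; case: eqP => [kE|]; last by rewrite mulr0.
  by rewrite kE tpermK FK eqxx in uk.
apply/rowP=> k; rewrite mulmxDl !mxE hvecE !mxE !eqxx /=.
set f := fun i => \sum_l G i 0 l * phi l 0.
rewrite -/(f i) -/(f j) -[\sum_l G k 0 l * _]/(f k) -[\sum_l G _ 0 l * _]/(f _).
have [->|ij] := eqVneq i j.
  by rewrite tperm1 perm1 F2_addrr mul0r addr0.
case: tpermP => [->|->|/eqP/negPf-> /eqP/negPf->].
- by rewrite eqxx (negPf ij) addr0 mulr1 addrA F2_addrr add0r.
- by rewrite eqxx eq_sym (negPf ij) add0r mulr1 addrCA F2_addrr addr0.
by rewrite addr0 mulr0 addr0.
Qed.

Lemma eps_tperm i j k :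
  eps (tperm i j k) = eps k + (k \in [set i; j])%:R *: (eps i + eps j).
Proof.
rewrite !inE; case: tpermP => [->|->|/eqP/negPf-> /eqP/negPf->].
- by rewrite eqxx scale1r addrA F2_addrrV add0r.
- by rewrite eqxx orbT scale1r addrCA F2_addrrV addr0.
by rewrite scale0r addr0.
Qed.

Lemma lambda_pswap b i j : i != j ->
  lambdaM (actOmega (pswap b i j) (fano_of F)) =
  swapped F (b (+) (F 0 \in [set i; j])) (G i + G j).
Proof.
move=> ij; have xO: fano_of F \in Omega240 by apply/fano_ofP; exists F.
have p0: G i + G j != 0 by rewrite addr_eq0 F2_oppr (inj_eq injG).
rewrite lambdaM_actOmega ?pswap_WD8 // actV_lambda //.
have injt: injective (tperm i j \o F) by apply: inj_comp => //; apply: perm_inj.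
rewrite lambda_fano // -imset_comp -(swappedE _ (G i)) //.
rewrite addrA F2_addrrV add0r !GK; apply: eq_imset => phi /=.
rewrite -vcosetD; congr vcoset; rewrite hvec_tperm eps_tperm.
have -> : ind (if b then [set i; j] else set0) = b%:R *: (eps i + eps j).
  case: b; last by rewrite scale0r /ind big_set0.
  by rewrite scale1r /ind big_setU1 ?inE // big_set1.
rewrite F2_natr_addb !scalerDl -!addrA; congr (_ + _).
rewrite addrCA; congr (_ + _).
by rewrite [LHS]addrA [LHS]addrC.
Qed.

(** The image of a plane under a swap depends only on the parallel class of the
    swapped pair and on a parity. *)
Lemma actOmega_pswap b c i j k m : i != j -> k != m -> G i + G j = G k + G m ->
  b (+) (F 0 \in [set i; j]) = c (+) (F 0 \in [set k; m]) ->
  actOmega (pswap b i j) (fano_of F) = actOmega (pswap c k m) (fano_of F).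
Proof.
move=> ij km p_eq c_eq.
have xO: fano_of F \in Omega240 by apply/fano_ofP; exists F.
apply: lambdaM_inj.
- by case: (actOmegaP (pswap_WD8 b ij) xO).
- by case: (actOmegaP (pswap_WD8 c km) xO).
by rewrite !lambda_pswap // p_eq c_eq.
Qed.

(** * Pairs of labels in a parallel class *)

Lemma triple_parallel e a b : [set e; a; b] \in fano_of F ->
  [/\ a != b, F 0 != e, G a + G b = G e & F 0 \notin [set a; b]].
Proof.
move=> T; have := card_triple injF T.
rewrite -setUA cardsU1 cards2 !inE negb_or => cT.
have [ea [eb ab]] : e != a /\ e != b /\ a != b.
  by move: cT; case: (e != a); case: (e != b); case: (a != b).
case/imsetP: T => _ /imsetP[W rW ->] TE; rewrite inE in rW.
have inW k : k \in [set e; a; b] -> G k != 0 /\ (G k <= W)%MS.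
  by rewrite TE => /imsetP[u]; rewrite !inE => /andP[u0 uW] ->; rewrite FK.
have [|e0 eW] := inW e; first by rewrite !inE eqxx.
have [|a0 aW] := inW a; first by rewrite !inE eqxx orbT.
have [|b0 bW] := inW b; first by rewrite !inE eqxx orbT.
have l_neq k : G k != 0 -> F 0 != k by apply: contraNneq => <-; rewrite FK.
split=> //; [exact: l_neq | | by rewrite negb_or !l_neq].
have ab' : G a != G b by rewrite (inj_eq injG).
have eqW : (G a + G b == W)%MS.
  have sW : (G a + G b <= W)%MS by rewrite addsmx_sub aW bW.
  by rewrite -(mxrank_leqif_eq sW) span2 // (eqP rW).
move: eW; rewrite -(eqmxP eqW) sub_span2 !inE (negPf e0) !(inj_eq injG).
by rewrite (negPf ea) (negPf eb) => /eqP.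
Qed.

Lemma pair_with_basepoint_parity p (beta : bool) : p != 0 ->
  exists k m, [/\ k != m, G k + G m = p & (F 0 \in [set k; m]) = beta].
Proof.
move=> p0; case: beta.
  exists (F 0), (F p); rewrite !inE eqxx (inj_eq injF) eq_sym p0 !FK add0r.
  by split.
have [q q0 pq] := ex_other p; exists (F q), (F (q + p)).
rewrite !inE !(inj_eq injF) !FK addrA F2_addrrV add0r.
rewrite -[q == _]subr_eq0 opprD addrA subrr add0r oppr_eq0.
rewrite !(eq_sym 0) addr_eq0 F2_oppr (negPf q0) (eq_sym q) (negPf pq).
by split.
Qed.

(** More than half of the labels must contain a pair with difference p, since
    they cannot be disjoint from their translate by p. *)
Lemma pair_in_large_set p (A : {set 'I_8}) : p != 0 -> (4 < #|A|)%N ->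
  exists k m, [/\ k \in A, m \in A, k != m & G k + G m = p].
Proof.
move=> p0 cA; pose h k := F (G k + p).
have injh: injective h by move=> k m /injF/addIr/injG.
have /set0Pn[k /setIP[kA /imsetP[m mA kE]]] : A :&: h @: A != set0.
  apply/eqP=> I0; have := cardsUI A (h @: A).
  rewrite I0 cards0 addn0 (card_imset _ injh) => cU.
  have := max_card (mem (A :|: h @: A)).
  rewrite card_ord cU leqNgt => /negP[].
  exact: leq_trans (leq_add cA cA).
exists k, m; split=> //; last by rewrite kE FK addrAC F2_addrrV add0r.
by rewrite -(inj_eq injG) kE FK -subr_eq0 addrC addKr.
Qed.

End Labelling.

Lemma card_first_five : #|[set k : 'I_8 | (k < 5)%N]| = 5.
Proof. by rewrite -sum1dep_card big_mkcond !big_ord_recl big_ord0. Qed.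

(** * The relations between swaps *)

Theorem proposition4p2 (x : {set {set 'I_8}})
    (l e a1 b1 a2 b2 a3 b3 : 'I_8)
    (x_Omega : x \in Omega240)
    (l_basepoint : is_basepoint x l)
    (e_label : e \in cover x)
    (triples_e : [set A in x | e \in A] =
       [set [set e; a1; b1]; [set e; a2; b2]; [set e; a3; b3]]) :
  [/\ actOmega (stransp l e) x = actOmega (transp a1 b1) x /\
      actOmega (stransp a1 b1) x = actOmega (transp l e) x,
      (actOmega (transp a1 b1) x = actOmega (transp a2 b2) x /\
       actOmega (transp a2 b2) x = actOmega (transp a3 b3) x) /\
      (actOmega (stransp a1 b1) x = actOmega (stransp a2 b2) x /\
       actOmega (stransp a2 b2) x = actOmega (stransp a3 b3) x),
      (forall i j : 'I_8, (i < j)%N -> exists c d : 'I_8,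
         (c < d)%N /\ actOmega (stransp i j) x = actOmega (transp c d) x)
    & (forall i j : 'I_8, (i < j)%N -> exists c d : 'I_8,
         [/\ (c < d)%N, (d < 5)%N
           & actOmega (transp i j) x = actOmega (transp c d) x \/
             actOmega (transp i j) x = actOmega (stransp c d) x])].
Proof.
case/fano_ofP: x_Omega l_basepoint triples_e => F injF {e_label}->.
have [G FK GK] := labelling_bij injF.
rewrite is_basepoint_fano // => /eqP->.
have triple A : A \in [set A in fano_of F | e \in A] -> A \in fano_of F.
  by rewrite inE => /andP[].
move=> TE; rewrite TE in triple.
have [|ab1 le p1 n1] := triple_parallel FK GK (e := e) (a := a1) (b := b1).
  by apply: triple; rewrite !inE eqxx.
have [|ab2 _ p2 n2] := triple_parallel FK GK (e := e) (a := a2) (b := b2).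
  by apply: triple; rewrite !inE eqxx orbT.
have [|ab3 _ p3 n3] := triple_parallel FK GK (e := e) (a := a3) (b := b3).
  by apply: triple; rewrite !inE eqxx !orbT.
have l_in : F 0 \in [set F 0; e] by rewrite !inE eqxx.
have p_le : G (F 0) + G e = G e by rewrite FK add0r.
have swapE := @actOmega_pswap F G FK GK.
have transpE i j : transp i j = pswap false i j by [].
have stranspE i j : stransp i j = pswap true i j by [].
have neq (i j : 'I_8) : (i < j)%N -> i != j.
  by move=> ij; rewrite -val_eqE neq_ltn ij.
have dir_neq0 i j : i != j -> G i + G j != 0.
  by move=> ij; rewrite addr_eq0 F2_oppr (inj_eq (can_inj GK)).
split.
- by split; rewrite stranspE transpE; apply: swapE => //;
    rewrite ?p_le // l_in (negPf n1).
- by split; split; rewrite ?stranspE ?transpE; apply: swapE => //;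
    rewrite ?p1 ?p2 ?p3 // (negPf n2) ?(negPf n1) ?(negPf n3).
- move=> i j /neq ij.
  have [k [m [km kmE lkm]]] :=
    pair_with_basepoint_parity FK (~~ (F 0 \in [set i; j])) (dir_neq0 _ _ ij).
  have E : actOmega (stransp i j) (fano_of F) = actOmega (transp k m) (fano_of F).
    rewrite stranspE transpE; apply: swapE ij km (esym kmE) _.
    by rewrite lkm; case: (_ \in _).
  case: (ltngtP k m) => [lt|gt|/val_inj km'].
  + by exists k, m.
  + by exists m, k; rewrite E !transpE pswapC.
  by rewrite km' eqxx in km.
move=> i j /neq ij.
have [k [m [+ + km kmE]]] := pair_in_large_set FK GK (dir_neq0 _ _ ij)
  (eq_leq (esym card_first_five)).
rewrite !inE => k5 m5.
wlog lt_km : k m km kmE k5 m5 / (k < m)%N.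
  move=> IH; case: (ltngtP k m) => [lt|gt|/val_inj km'].
  - exact: IH km kmE k5 m5 lt.
  - by apply: IH gt => //; rewrite 1?eq_sym 1?addrC.
  by rewrite km' eqxx in km.
exists k, m; split=> //.
have [|]:= eqVneq (F 0 \in [set i; j]) (F 0 \in [set k; m]) => l_eq.
  by left; rewrite !transpE; apply: swapE ij km (esym kmE) _; rewrite l_eq.
right; rewrite transpE stranspE; apply: swapE ij km (esym kmE) _.
by move: l_eq; do 2![case: (F 0 \in _)].
Qed.
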